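(* Let $H$ be a pre-Hilbert space, let $\mathcal I=\bigoplus_{n\in\mathbb N_0}H_n\subset\overline{\mathscr F(H)}$ be a pre-Fock subspace, and let $\varkappa$ be a squeezing relative to $\mathcal I$. For $x\in H$ let $a^*_\varkappa(x)\in\mathscr L(\mathcal I)$ be the (co)restriction of $\varkappa\ell^*(x)$ to $\mathcal I$. Then $\mathcal I_\varkappa:=((H_n)_{n\in\mathbb N_0},a^*_\varkappa)$ is an interacting Fock space based on $H$. Moreover, if $\xi_\varkappa\colon\mathcal I\to\overline{\mathscr F(H)}$ denotes the canonical (inclusion) embedding, then the unique vacuum-preserving linear map $\varkappa_{\xi_\varkappa}\in\mathscr L((H\otimes\mathcal D_{\mathcal I})\oplus\mathbb C\Omega,\mathcal D_{\mathcal I})$ with $\varkappa_{\xi_\varkappa}\ell^*(x)=\xi_\varkappa a^*_\varkappa(x)\xi_\varkappa^*$ for all $x\in H$ is $\varkappa$.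
   Context: All vector spaces are complex; direct sums and tensor products of pre-Hilbert spaces are algebraic; $\overline V$ is the completion of a pre-Hilbert space $V$; $\mathscr L(V,W)$ is the space of all linear maps $V\to W$, $\mathscr L(V)=\mathscr L(V,V)$. $\mathscr F(H)=\Omega\mathbb C\oplus\bigoplus_{n\ge1}H^{\otimes n}$ is the algebraic full Fock space with its natural inner product; $H^{\otimes0}:=\Omega\mathbb C$, $\Omega$ a unit vector. For $x\in H$, $\ell^*(x)\colon X\mapsto x\otimes X$ (with $x\otimes\Omega=x$) is the (bounded) creation operator on $\overline{\mathscr F(H)}$. For a subspace $\mathcal D\subset\overline{\mathscr F(H)}$, $(H\otimes\mathcal D)\oplus\Omega\mathbb C$ is regarded as a subspace of $\overline{\mathscr F(H)}$. A pre-Fock subspace of $\overline{\mathscr F(H)}$ is an algebraic direct sum $\mathcal I=\bigoplus_{n}H_n$ of subspaces $H_n\subset\overline{H^{\otimes n}}$ with $H_0=\Omega\mathbb C$. Put $\mathcal D_{\mathcal I}:=\mathcal I\oplus\mathcal I^\perp$ (complement in $\overline{\mathscr F(H)}$). A Fock map is a linear map fixing $\Omega$ and preserving degree (elements of $\overline{H^{\otimes n}}$ in the domain are mapped into $\overline{H^{\otimes n}}$). A squeezing relative to $\mathcal I$ is a Fock map $\varkappa\colon(H\otimes\mathcal D_{\mathcal I})\oplus\Omega\mathbb C\to\mathcal D_{\mathcal I}$ whose range is $\mathcal I$ and which vanishes on $H\otimes\mathcal I^\perp$. An interacting Fock space based on $H$ consists of pre-Hilbert spaces $H_n$ with $H_0=\Omega\mathbb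 C$, $\mathcal I=\bigoplus_nH_n$, and a linear map $a^*\colon H\to\mathscr L(\mathcal I)$ with $\operatorname{span}a^*(H)H_n=H_{n+1}$ for all $n\in\mathbb N_0$. The adjoint $\xi_\varkappa^*\colon\mathcal D_{\mathcal I}\to\mathcal I$ of the inclusion is the identity on $\mathcal I$ and $0$ on $\mathcal I^\perp$. *)

(* Defs.v *)
From HB Require Import structures.
From mathcomp Require Import all_boot all_order all_algebra sesquilinear.
From mathcomp Require Import boolp classical_sets topology normedtype.
From mathcomp Require Import reals complex.

Set Implicit Arguments.
Unset Strict Implicit.
Unset Printing Implicit Defensive.

Import Order.TTheory GRing.Theory Num.Theory.

Local Open Scope classical_set_scope.
Local Open Scope ring_scope.

(* The scalar field is an arbitrary [K : numClosedFieldType]; the theorem is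
   stated for [K = R[i]] with [R : realType], i.e. for the complex numbers.
   [dotp] is linear in its first argument and conjugate-linear in its second. *)

HB.mixin Record isPreHilbert (K : numClosedFieldType) V
    of GRing.Lmodule K V := {
  dotp : {dot V for (@Num.conj K)}
}.

#[short(type="preHilbertType")]
HB.structure Definition PreHilbert (K : numClosedFieldType) :=
  { V of GRing.Lmodule K V & isPreHilbert K V }.

Notation "''[' u , v ]" := (dotp u v)
  (format "''[' u ,  v ]") : ring_scope.

HB.mixin Record isHilbert (K : numClosedFieldType) V
    of CompleteNormedModule K V & isPreHilbert K V := {
  normr_dotp : forall u : V, `|u| ^+ 2 = '[u, u]
}.

#[short(type="hilbertType")]
HB.structure Definition Hilbert (K : numClosedFieldType) :=
  { V of CompleteNormedModule K V & isPreHilbert K V & isHilbert K V }.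

Section Subspaces.
Context {K : numClosedFieldType}.

Record subspace (V : lmodType K) := Subspace {
  subspace_set :> set V;
  subspace_closed : submod_closed (mem subspace_set)
}.

Definition subspace_app (V : lmodType K) (S : subspace V) : V -> Prop :=
  subspace_set S.
Coercion subspace_app : subspace >-> Funclass.

Section SubspaceType.
Context {V : lmodType K} (S : subspace V).

Definition subspace_pred : {pred V} := mem (S : set V).

HB.instance Definition _ :=
  GRing.isSubmodClosed.Build K V subspace_pred (subspace_closed S).

Record subv := Subv { subv_val : V; subv_valP : subv_val \in subspace_pred }.

HB.instance Definition _ := [isSub for subv_val].
HB.instance Definition _ := [Choice of subv by <:].
HB.instance Definition _ := [SubChoice_isSubLmodule of subv by <:].

End SubspaceType.

Section SubspaceOperations.
Context {V : lmodType K}.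
Implicit Types (S T : subspace V) (A : set V).

Definition in_subv S (x : V) (Sx : S x) : subv S :=
  Subv (mem_set Sx : x \in subspace_pred S).

Lemma subvP S (x : subv S) : S (\val x).
Proof. exact: set_mem (subv_valP x). Qed.

Lemma subspace0 S : S 0.
Proof. by have [/set_mem] := subspace_closed S. Qed.

Lemma subspaceD S x y : S x -> S y -> S (x + y).
Proof.
move=> Sx Sy; have [_ /(_ 1 x y)] := subspace_closed S.
by rewrite scale1r => /(_ (mem_set Sx) (mem_set Sy)) /set_mem.
Qed.

Lemma subspaceZ S c x : S x -> S (c *: x).
Proof.
move=> Sx; have [_ /(_ c x 0)] := subspace_closed S.
rewrite addr0 => /(_ (mem_set Sx)) h.
by apply/set_mem/h/mem_set/subspace0.
Qed.

Definition span_set A : set V :=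
  [set x | exists s : seq (K * V),
    (forall p, p \in s -> A p.2) /\ x = \sum_(p <- s) p.1 *: p.2].

Lemma span_closed A : submod_closed (mem (span_set A)).
Proof.
split=> [|c x y /set_mem[s [sA ->]] /set_mem[t [tA ->]]]; apply/mem_set.
  by exists [::]; rewrite big_nil; split.
exists ([seq (c * p.1, p.2) | p <- s] ++ t); split=> [p|].
  by rewrite mem_cat => /orP[/mapP[q /sA qA ->]|/tA].
rewrite big_cat big_map scaler_sumr; congr (_ + _).
by apply: eq_bigr => p _; rewrite scalerA.
Qed.

Definition span A : subspace V := Subspace (span_closed A).

Lemma mem_span A x : A x -> span A x.
Proof.
move=> Ax; exists [:: (1, x)]; split=> [p|]; first by rewrite inE => /eqP ->.
by rewrite big_seq1 scale1r.
Qed.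

Definition line (x : V) : subspace V := span [set x].

Definition dsum (Hn : nat -> subspace V) : subspace V :=
  span (\bigcup_n (Hn n : set V)).

Lemma add_closed S T :
  submod_closed (mem [set z | exists x y, [/\ S x, T y & z = x + y]]).
Proof.
split=> [|c z z' /set_mem[x [y [Sx Ty ->]]] /set_mem[x' [y' [Sx' Ty' ->]]]];
  apply/mem_set.
  by exists 0, 0; rewrite addr0; split=> //; exact: subspace0.
exists (c *: x + x'), (c *: y + y'); split.
- by apply: subspaceD => //; exact: subspaceZ.
- by apply: subspaceD => //; exact: subspaceZ.
- by rewrite scalerDr addrACA.
Qed.

Definition addsub S T : subspace V := Subspace (add_closed S T).

Lemma addsubl S T x : S x -> addsub S T x.
Proof. by move=> Sx; exists x, 0; rewrite addr0; split=> //; exact: subspace0. Qed.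

Lemma addsubr S T x : T x -> addsub S T x.
Proof. by move=> Tx; exists 0, x; rewrite add0r; split=> //; exact: subspace0. Qed.

End SubspaceOperations.

Section Orthogonal.
Context {V : preHilbertType K}.

Lemma ortho_closed (A : set V) :
  submod_closed (mem [set x : V | forall y, A y -> '[x, y] = 0]).
Proof.
split=> [|c x y /set_mem/= xA /set_mem/= yA]; apply/mem_set => z Az /=.
  by rewrite linear0l.
by rewrite linearPl/= xA// yA// mulr0 addr0.
Qed.

Definition orthoc (A : set V) : subspace V := Subspace (ortho_closed A).

End Orthogonal.
End Subspaces.

(* A realization of the completed full Fock space over [H]: [vac] is the
   vacuum, [cre x X] is [x (x) X], i.e. [cre x] is the creation operator, and
   the elementary tensor of a word [w = [:: x1; ..; xn]] is
   [x1 (x) .. (x) xn = cre x1 (.. (cre xn vac))].  The span of the elementary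
   tensors, with the inner product prescribed by [tens_dot], is the algebraic
   full Fock space, and the Hilbert space is its completion by [tens_dense].
   These data are unique up to a unique unitary. *)
Record fockSpace (K : numClosedFieldType) (H : preHilbertType K) := FockSpace {
  fock_sort :> hilbertType K;
  vac : fock_sort;
  cre : {bilinear H -> fock_sort -> fock_sort};
  tens := fun w : seq H => foldr cre vac w;
  cre_continuous : forall x : H, continuous (cre x);
  tens_dot : forall v w : seq H,
    '[tens v, tens w] =
    if size v == size w then \prod_(p <- zip v w) '[p.1, p.2] else 0;
  tens_dense : closure (span (range tens)) = [set: fock_sort]
}.

Section Squeezing.
Context {K : numClosedFieldType} {H : preHilbertType K} {F : fockSpace H}.

(* The closure of the [n]-th tensor power of [H]. *)
Definition cl_tens (n : nat) : set F :=
  closure (span [set tens F w | w in [set w : seq H | size w = n]]).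

Record preFock := PreFock {
  pf_n :> nat -> subspace F;
  pf_deg : forall n, (pf_n n : set F) `<=` cl_tens n;
  pf_vac : (pf_n 0 : set F) = line (vac F)
}.

(* [H (x) S] as a subspace of [F], for a subspace [S] of [F]. *)
Definition htensor (S : set F) : subspace F :=
  span [set z | exists x : H, exists2 X : F, S X & z = cre F x X].

Section Relative.
Variable P : preFock.

Definition pf_sum : subspace F := dsum P.

Definition pf_D : subspace F := addsub pf_sum (orthoc pf_sum).

Definition pf_dom : subspace F := addsub (htensor pf_D) (line (vac F)).

Lemma dom_vac_subproof : pf_dom (vac F).
Proof. exact/addsubr/mem_span. Qed.

Lemma D_vac_subproof : pf_D (vac F).
Proof.
apply/addsubl/mem_span; exists 0%N => //.
by rewrite pf_vac; exact: mem_span.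
Qed.

Lemma dom_cre_subproof x (X : subv pf_D) : pf_dom (cre F x (\val X)).
Proof.
apply/addsubl/mem_span; exists x, (\val X) => //; exact: (@subvP _ _ pf_D).
Qed.

Definition dom_vac : subv pf_dom := in_subv dom_vac_subproof.
Definition D_vac : subv pf_D := in_subv D_vac_subproof.
Definition dom_cre (x : H) (X : subv pf_D) : subv pf_dom :=
  in_subv (dom_cre_subproof x X).

Definition D_incl (u : subv pf_sum) : subv pf_D :=
  in_subv (addsubl (orthoc pf_sum) (subvP u)).

(* [xi] is the inclusion and [xistar] its adjoint, chosen through the defining
   property of an adjoint; see [xistar_uniq], [xistar_id], [xistar_ortho]. *)
Definition xi (u : subv pf_sum) : F := \val u.

Lemma xistar_subproof (X : subv pf_D) :
  exists u : subv pf_sum, forall v, '[\val u, xi v] = '[\val X, xi v].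
Proof.
have [u [w [Iu Iw ->]]] := subvP X.
exists (in_subv Iu) => v; rewrite linearDl /= [X in _ + X]Iw ?addr0//.
exact: (subvP v).
Qed.

Definition xistar (X : subv pf_D) : subv pf_sum :=
  projT1 (cid (xistar_subproof X)).

Lemma xistar_adj X v : '[\val (xistar X), xi v] = '[\val X, xi v].
Proof. exact: (projT2 (cid (xistar_subproof X))). Qed.

Lemma xistar_uniq X u :
  (forall v, '[\val u, xi v] = '[\val X, xi v]) -> xistar X = u.
Proof.
move=> uX; apply/eqP; rewrite -subr_eq0; apply: contraT => nz.
have: \val (xistar X - u) != 0.
  by apply: contra nz => /eqP w0; apply/eqP/val_inj; rewrite w0.
set w := xistar X - u => /(@neq0_dnorm_gt0 _ _ _ dotp).
have -> : '[\val w, \val w] = '[\val (xistar X) - \val u, xi w] by [].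
by rewrite linearBl /= xistar_adj uX subrr ltxx.
Qed.

Lemma xistar_id u : xistar (D_incl u) = u.
Proof. exact: xistar_uniq. Qed.

Lemma xistar_ortho X : orthoc pf_sum (\val X) -> xistar X = 0.
Proof.
by move=> Xo; apply: xistar_uniq => v; rewrite linear0l Xo//; exact: (subvP v).
Qed.

(* [k] maps [(H (x) D) (+) K Om] to [D]; [dom_vac] and [D_vac] are both the
   vacuum, and [dom_cre x X] is [l*(x) X] as an element of the domain. *)
Record squeezing := Squeezing {
  sq_map :> {linear subv pf_dom -> subv pf_D};
  sq_vac : sq_map dom_vac = D_vac;
  sq_deg : forall n (X : subv pf_dom),
    cl_tens n (\val X) -> cl_tens n (\val (sq_map X));
  sq_range : range (fun X => \val (sq_map X)) = pf_sum;
  sq_ortho : forall X : subv pf_dom,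
    htensor (orthoc pf_sum) (\val X) -> sq_map X = 0
}.

Section Creation.
Variables (k : squeezing) (x : H).

Lemma sq_mem (X : subv pf_dom) : pf_sum (\val (k X)).
Proof. by rewrite -[subspace_app _ _]/((pf_sum : set F) _) -(sq_range k); exists X. Qed.

Definition sq_cre (u : subv pf_sum) : subv pf_sum :=
  in_subv (sq_mem (dom_cre x (D_incl u))).

Lemma sq_cre_linear : linear sq_cre.
Proof.
move=> c u v; apply/val_inj; rewrite linearP /=.
suff -> : dom_cre x (D_incl (c *: u + v)) =
    c *: dom_cre x (D_incl u) + dom_cre x (D_incl v) by rewrite !linearP.
by apply/val_inj; exact: (linearPr (cre F) x c (\val u) (\val v)).
Qed.

HB.instance Definition _ :=
  GRing.isLinear.Build K (subv pf_sum) (subv pf_sum) _ sq_cre sq_cre_linear.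

End Creation.

Definition astar (k : squeezing) (x : H) :
  {linear subv pf_sum -> subv pf_sum} := sq_cre k x.

End Relative.
End Squeezing.

Arguments preFock {K H} F.

(* The pre-Hilbert spaces [Hn n] are given as mutually orthogonal subspaces of
   a common pre-Hilbert space [E], so that [dsum Hn] is their direct sum. *)
Record is_interacting_fock (K : numClosedFieldType) (H E : preHilbertType K)
    (Om : E) (Hn : nat -> subspace E)
    (a : H -> {linear subv (dsum Hn) -> subv (dsum Hn)}) : Prop := {
  ifs_ortho : forall m n, m != n ->
    forall u v, Hn m u -> Hn n v -> '[u, v] = 0;
  ifs_unit : '[Om, Om] = 1;
  ifs_vac : (Hn 0 : set E) = line Om;
  ifs_linear : forall u, linear (fun x => a x u);
  ifs_span : forall n,
    (span [set z | exists x : H, exists2 u : subv (dsum Hn),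
                     Hn n (\val u) & z = \val (a x u)] : set E) = Hn n.+1
}.

Arguments is_interacting_fock {K H E} Om Hn a.

(* [k'] preserves the vacuum and [k' l*(x) = xi a*_k(x) xi*] for all [x]. *)
Definition represents_creation (K : numClosedFieldType) (H : preHilbertType K)
    (F : fockSpace H) (P : preFock F)
    (a : H -> {linear subv (pf_sum P) -> subv (pf_sum P)})
    (k' : {linear subv (pf_dom P) -> subv (pf_D P)}) : Prop :=
  k' (dom_vac P) = D_vac P /\
  forall (x : H) (X : subv (pf_D P)),
    \val (k' (dom_cre x X)) = xi (a x (xistar X)).

(* Main.v *)
From mathcomp Require Import all_boot all_order all_algebra.
From mathcomp Require Import boolp classical_sets topology normedtype.
From mathcomp Require Import reals complex.
Require Import Defs.

(** The pieces of an orthogonally graded subspace can be recovered from vectors: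
    [cl_tens m] and [cl_tens n] are orthogonal for [m != n] (the inner product
    of words of different lengths vanishes, and an orthogonal complement is
    closed by the Cauchy-Schwarz inequality), so a vector of degree [n] that is
    the sum of a vector of degree [n] and of pieces of other degrees has no
    such other pieces ([degree_component]).

    The range of a squeezing [k] is all of the graded space [I].  Its domain is
    spanned by the vacuum and the vectors [cre x X] with [X] in [I] plus its
    orthogonal complement; [k] kills the part of [X] that is orthogonal to [I],
    so [k (cre x X) = a*(x) (xi* X)] ([squeezing_xistar]).  This is already the
    representation of the creators by [k], and since the right-hand side
    depends on the creators only, a vacuum-preserving linear map with this
    property is determined on a spanning set.

    For the spanning condition of an interacting Fock space, [a*(x)] raises
    degrees by one, because both tensoring with [x] and [k] respect the grading
    ([astar_deg]).  Conversely, by splitting [xi* X] into its homogeneous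
    pieces, each value of [k] is a vector of [span a*(H) H_n] plus pieces of
    degree other than [n+1] ([squeezing_decomp]).  A vector of [H_(n+1)] is such
    a value, and having degree [n+1] it lies in [span a*(H) H_n]. *)

Set Implicit Arguments.
Unset Strict Implicit.
Unset Printing Implicit Defensive.

Import Order.TTheory GRing.Theory Num.Theory.

Local Open Scope classical_set_scope.
Local Open Scope ring_scope.

(** * Induction on spans *)

Section SubspaceInduction.
Context {K : numClosedFieldType}.

Lemma span_sub (V : lmodType K) (A : set V) (S : subspace V) :
  A `<=` S -> (span A : set V) `<=` S.
Proof.
move=> AS x [s [sA ->]]; rewrite -[_ (\sum_(_ <- _) _)]/(S _).
elim: s sA => [|p s IH] sA; first by rewrite big_nil; exact: subspace0.
rewrite big_cons; apply: subspaceD.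
  by apply/subspaceZ/AS/sA; rewrite mem_head.
by apply: IH => q qs; apply: sA; rewrite inE qs orbT.
Qed.

Lemma image_submod_closed (U V : lmodType K) (f : {linear U -> V}) (T : subspace U) :
  submod_closed (mem (f @` T)).
Proof.
split=> [|c _ _ /set_mem[x Tx <-] /set_mem[y Ty <-]]; apply/mem_set.
  by exists 0; [exact: subspace0|exact: linear0].
exists (c *: x + y); last exact: linearP.
by apply: subspaceD => //; exact: subspaceZ.
Qed.

Lemma preimage_submod_closed (U V : lmodType K) (f : {linear U -> V})
  (T : subspace V) : submod_closed (mem (f @^-1` T)).
Proof.
split=> [|c x y /set_mem Tx /set_mem Ty]; apply/mem_set.
  by rewrite /preimage/= linear0; exact: subspace0.
by rewrite /preimage/= linearP; apply: subspaceD => //; exact: subspaceZ.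
Qed.

(** Linear maps out of a subspace are only defined on the subtype [subv S], so
    the induction on a span has to carry a proof of membership: the vectors that
    lift to some [Y : subv S] with [f Y] in [T] form a subspace, the image under
    [val] of the preimage of [T]. *)
Lemma subv_span_ind (V W : lmodType K) (A : set V) (S : subspace V)
    (f : {linear subv S -> W}) (T : subspace W) :
    A `<=` S -> (S : set V) `<=` span A ->
    (forall X : subv S, A (\val X) -> T (f X)) ->
  forall X, T (f X).
Proof.
move=> AS SA AT X.
pose valS : {linear subv S -> V} := val.
pose I := Subspace (image_submod_closed valS (Subspace (preimage_submod_closed f T))).
have : (span A : set V) `<=` I.
  by apply: span_sub => x Ax; exists (in_subv (AS _ Ax)) => //; exact: AT.
by move=> /(_ _ (SA _ (subvP X)))[Y /= TfY /val_inj <-].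
Qed.

End SubspaceInduction.

(** * Orthogonality and closures *)

Section ClosedOrthogonal.
Context {K : numClosedFieldType}.

(** The squared length of [b u - c v], where [c = '[u, v]] and [b = '[v, v]],
    equals [b (b '[u, u] - |c|^2)]. *)
Lemma cauchy_schwarz (V : preHilbertType K) (u v : V) :
  `|'[u, v]| ^+ 2 <= '[u, u] * '[v, v].
Proof.
have [->|v0] := eqVneq v 0; first by rewrite !linear0r normr0 expr0n mulr0.
have b_gt0 : 0 < '[v, v] by rewrite (dnorm_gt0 dotp).
have := dnorm_ge0 dotp ('[v, v] *: u - '[u, v] *: v).
rewrite dnormB !dnormZ linearZl_LR linearZr_LR/=.
have nn : (`|'[u, v]| ^+ 2)^* = `|'[u, v]| ^+ 2.
  by rewrite conj_Creal// rpredX// normr_real.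
have cv : '[v, v]^* = '[v, v] by rewrite conj_Creal// gtr0_real.
rewrite (ger0_norm (ltW b_gt0)) [_^* * _]mulrC -normCK rmorphM /= nn cv.
rewrite [X in _ + X - _]mulrC opprD addrA addrK expr2 -mulrA -mulrBr.
by rewrite pmulr_rge0// subr_ge0 mulrC.
Qed.

(** If [c = '[x, y]] is not zero, the ball around [x] of radius [|c| / |y|]
    misses the vectors orthogonal to [y]: any such [b] has [c = '[x - b, y]],
    hence [|c| <= |x - b| |y|]. *)
Lemma closed_orthoc (V : hilbertType K) (A : set V) : closed (orthoc A : set V).
Proof.
move=> x clx y Ay; apply: contrapT => /eqP c0.
have y0 : y != 0 by apply: contra_neq c0 => ->; rewrite linear0r.
have e_gt0 : 0 < `|'[x, y]| / `|y| by rewrite divr_gt0 ?normr_gt0.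
have [b [/= bA]] := clx _ (nbhsx_ballx _ _ e_gt0).
rewrite -ball_normE /= ltr_pdivlMr ?normr_gt0//.
have -> : '[x, y] = '[x - b, y] by rewrite linearBl /= (bA _ Ay) subr0.
apply/negP; rewrite -real_leNgt ?normr_real// ?realM ?normr_real//.
rewrite -ler_sqr ?nnegrE ?mulr_ge0// exprMn !normr_dotp.
exact: cauchy_schwarz.
Qed.

Lemma closure_span_ortho (V : hilbertType K) (A B : set V) :
    (forall a b, A a -> B b -> '[a, b] = 0) ->
  forall u v, closure (span A) u -> closure (span B) v -> '[u, v] = 0.
Proof.
have half (C D : set V) : (forall a b, C a -> D b -> '[a, b] = 0) ->
    forall u v, D v -> closure (span C) u -> '[u, v] = 0.
  move=> CD u v Dv uC; suff : orthoc D u by apply.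
  move: u uC; rewrite closureE; apply: smallest_sub; first exact: closed_orthoc.
  by apply: span_sub => a Ca b Db; exact: CD.
move=> AB u v uA vB; apply: (half A (closure (span B))) vB uA => a b Aa bB.
apply/eqP; rewrite herm_eq0C; apply/eqP; apply: (half B A) Aa bB => c d Bc Ad.
by apply/eqP; rewrite herm_eq0C; apply/eqP; exact: AB.
Qed.

End ClosedOrthogonal.

(** * The grading of the completed Fock space *)

Section Grading.
Context {K : numClosedFieldType} {H : preHilbertType K} {F : fockSpace H}.

Lemma cl_tens_ortho m n (u v : F) :
  m != n -> cl_tens m u -> cl_tens n v -> '[u, v] = 0.
Proof.
move=> mn; apply: closure_span_ortho => {u v} _ _ [v /= vm <-] [w /= wn <-].
by rewrite tens_dot vm wn (negbTE mn).
Qed.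

(** [cre x] prepends [x] to words, and by continuity this passes to closures. *)
Lemma cl_tens_cre n (x : H) (u : F) : cl_tens n u -> cl_tens n.+1 (cre F x u).
Proof.
have creK : closed (cre F x @^-1` cl_tens n.+1).
  by apply: (continuous_closedP _).1; [exact: cre_continuous|exact: closed_closure].
move: u; rewrite {1}/cl_tens closureE; apply: smallest_sub => // u un.
apply: subset_closure.
move: u un; set T := span [set tens F w | w in [set w : seq H | size w = n.+1]].
apply: (@span_sub _ _ _ (Subspace (preimage_submod_closed (cre F x) T))) => _ [w /= wn <-].
by apply: mem_span; exists (x :: w) => //=; rewrite wn.
Qed.

End Grading.

(** * Pre-Fock subspaces and squeezings *)

Section SqueezingTheory.
Context {K : numClosedFieldType} {H : preHilbertType K} {F : fockSpace H}.
Context {P : preFock F}.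

Definition off_degree (n : nat) : subspace F :=
  span (\bigcup_(m in [set m | m != n]) (P m : set F)).

Lemma pf_ortho m n (u v : F) : m != n -> P m u -> P n v -> '[u, v] = 0.
Proof. by move=> mn um vn; exact: cl_tens_ortho mn (pf_deg um) (pf_deg vn). Qed.

Lemma off_degree_ortho n (u v : F) : off_degree n u -> cl_tens n v -> '[u, v] = 0.
Proof.
move=> un vn; suff : (off_degree n : set F) `<=` orthoc [set v].
  by move=> /(_ _ un); apply.
apply: span_sub => w [m /= mn wm] _ ->.
exact: cl_tens_ortho mn (pf_deg wm) vn.
Qed.

Lemma pf_sum_deg n u : P n u -> pf_sum P u.
Proof. by move=> un; apply: mem_span; exists n. Qed.

(** The stray part [r = z - s] is orthogonal to [z] and to [s], both of degree
    [n], hence to itself.  Stating this for an arbitrary [S] lets it serve both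
    for [P n] itself and for the span of the created vectors. *)
Lemma degree_component n (S : subspace F) (z : F) :
    (S : set F) `<=` cl_tens n ->
  cl_tens n z -> addsub S (off_degree n) z -> S z.
Proof.
move=> Sn zn [s [r [Ss rn zE]]]; suff r0 : r = 0 by rewrite zE r0 addr0.
have rE : r = z - s by rewrite zE addrC addKr.
apply/eqP; rewrite -(dnorm_eq0 dotp) {2}rE linearBr /=.
by rewrite (off_degree_ortho rn zn) (off_degree_ortho rn (Sn _ Ss)) subrr.
Qed.

Lemma pf_sum_homog n u : pf_sum P u -> cl_tens n u -> P n u.
Proof.
move=> Iu un; apply: (degree_component (@pf_deg _ _ _ P n) un).
apply: span_sub Iu => w [m _ wm].
have [<-|mn] := eqVneq m n; first exact: addsubl.
by apply/addsubr/mem_span; exists m.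
Qed.

Lemma pf_dom_gen : (pf_dom P : set F) `<=`
  span ([set z | exists x : H, exists2 X : F, pf_D P X & z = cre F x X]
        `|` [set vac F]).
Proof.
move=> _ [u [v [uH vL ->]]]; apply: (@subspaceD _ _ (span _)).
  by apply: span_sub uH => w wH; apply: mem_span; left.
by apply: span_sub vL => w wH; apply: mem_span; right.
Qed.

Lemma pf_dom_ind (W : lmodType K) (f : {linear subv (pf_dom P) -> W})
    (T : subspace W) :
    T (f (dom_vac P)) -> (forall x X, T (f (dom_cre x X))) ->
  forall X, T (f X).
Proof.
move=> Tvac Tcre; apply: subv_span_ind pf_dom_gen _ => [z [[x [X DX ->]]|->]|].
- exact: (@subvP _ _ _ (dom_cre x (in_subv DX))).
- exact: dom_vac_subproof.
move=> X [[x [Y DY XE]]|XE].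
  by have -> : X = dom_cre x (in_subv DY) by exact: val_inj.
by have -> : X = dom_vac P by exact: val_inj.
Qed.

Section Creation.
Variable k : squeezing P.

(** Writing [X = u + w] with [u] in the pre-Fock space and [w] orthogonal to it,
    [k] kills [cre x w] and [xi*] maps [X] to [u]. *)
Lemma squeezing_xistar x X :
  \val (k (dom_cre x X)) = \val (astar k x (xistar X)).
Proof.
have [u [w [Iu Iw XE]]] := subvP X.
have wD : pf_D P w by exact: addsubr.
have -> : X = D_incl (in_subv Iu) + in_subv wD by exact: val_inj.
set U := in_subv Iu; set w' := in_subv wD.
have -> : xistar (D_incl U + w') = U.
  apply: xistar_uniq => v; rewrite linearDl /= [X in _ + X]Iw ?addr0//.
  exact: (subvP v).
have -> : dom_cre x (D_incl U + w') = dom_cre x (D_incl U) + dom_cre x w'.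
  by apply: val_inj; exact: linearDr.
rewrite linearD /= [X in _ + \val X]sq_ortho ?addr0//.
by apply: mem_span; exists x, w.
Qed.

Lemma astar_deg n x (u : subv (pf_sum P)) :
  P n (\val u) -> P n.+1 (\val (astar k x u)).
Proof.
move=> un; apply: pf_sum_homog; first exact: (subvP (astar k x u)).
by apply: sq_deg; exact: cl_tens_cre (pf_deg un).
Qed.

Definition astar_span (n : nat) : subspace F :=
  span [set z | exists x : H, exists2 u : subv (pf_sum P),
                  P n (\val u) & z = \val (astar k x u)].

Lemma astar_span_sub n : (astar_span n : set F) `<=` P n.+1.
Proof. by apply: span_sub => _ [x [u un ->]]; exact: astar_deg. Qed.

(** On the generators of the domain: [k] fixes the vacuum, of degree [0], and
    [k (cre x X)] is [a*(x) u] with [u = xi* X]; the piece of [u] of degree [m]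
    contributes to degree [m + 1], so only [m = n] contributes to degree
    [n + 1]. *)
Lemma squeezing_decomp n X :
  addsub (astar_span n) (off_degree n.+1) (\val (k X)).
Proof.
pose vk : {linear subv (pf_dom P) -> F} := (val : {linear subv (pf_D P) -> F}) \o k.
apply: (@pf_dom_ind _ vk) => [|x Y].
  rewrite -[vk _]/(\val (k _)) sq_vac; apply/addsubr/mem_span; exists 0%N => //.
  by rewrite pf_vac; exact: mem_span.
rewrite -[vk _]/(\val (k _)) squeezing_xistar; move: (xistar Y) => u {Y}.
pose va : {linear subv (pf_sum P) -> F} :=
  (val : {linear subv (pf_sum P) -> F}) \o astar k x.
apply: (@subv_span_ind _ _ _ (\bigcup_n (P n : set F)) _ va) => // [|v [m _ vm]].
  by move=> v vP; exact: mem_span.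
have [mn|mn] := eqVneq m n.
  by apply/addsubl/mem_span; exists x, v; rewrite // -mn.
by apply/addsubr/mem_span; exists m.+1 => //; exact: astar_deg.
Qed.

Lemma astar_spanE n : (astar_span n : set F) = P n.+1.
Proof.
apply/seteqP; split=> [|z zn]; first exact: astar_span_sub.
have [X _ XE] : range (fun X => \val (k X)) z.
  by rewrite sq_range; exact: pf_sum_deg zn.
apply: (@degree_component _ (astar_span n)) (pf_deg zn) _.
  by move=> y /astar_span_sub /pf_deg.
by rewrite -XE; exact: squeezing_decomp.
Qed.

Lemma astar_linearl (u : subv (pf_sum P)) : linear (fun x => astar k x u).
Proof.
move=> c x y; apply: val_inj => /=.
have -> : dom_cre (c *: x + y) (D_incl u) =
    c *: dom_cre x (D_incl u) + dom_cre y (D_incl u).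
  by apply: val_inj; exact: (linearPl (cre F)).
by rewrite !linearP.
Qed.

End Creation.
End SqueezingTheory.

Theorem theorem4p5 (R : realType) (H : preHilbertType R[i]) (F : fockSpace H)
    (P : preFock F) (k : squeezing P) :
  is_interacting_fock (vac F) P (astar k) /\
  (represents_creation (astar k) k /\
   forall k' : {linear subv (pf_dom P) -> subv (pf_D P)},
     represents_creation (astar k) k' -> forall X, k' X = k X).
Proof.
split; [split|split; [split|]].
- by move=> m n mn u v; exact: pf_ortho.
- by rewrite -[vac F]/(tens F [::]) tens_dot big_nil.
- exact: pf_vac.
- exact: astar_linearl.
- exact: astar_spanE.
- exact: sq_vac.
- exact: squeezing_xistar.
move=> k' [k'vac k'cre] X; apply/eqP; rewrite -subr_eq0; apply/eqP.
(* The induction asks for membership in a subspace: the difference of the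
   two maps is shown to lie in the zero subspace, spanned by no vectors. *)
pose d : {linear subv (pf_dom P) -> subv (pf_D P)} := k' \- k.
pose zero := @span R[i] (subv (pf_D P)) set0.
suff [s [sP dX]] : zero (d X).
  by rewrite -[LHS]/(d X) dX big_seq big1// => p /sP.
have zE Y : Y = 0 -> zero Y by move=> ->; exact: subspace0.
apply: pf_dom_ind => [|x Y]; apply: zE.
  by rewrite /d /= k'vac sq_vac subrr.
by apply/eqP; rewrite /d /= subr_eq0; apply/eqP/val_inj; rewrite k'cre squeezing_xistar.
Qed.
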